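(* Let $\mathbf{e}\in\mathbb{P}\mathrm{iez}$, let $\mathbf{h}$ be its leading harmonic part, $\mathbf{g}=\mathbf{e}-\mathbf{h}$, and $\mathbf{d}_2'=\mathbf{d}_2-\frac13\operatorname{tr}(\mathbf{d}_2)\mathbf{q}$ where $(\mathbf{d}_2)_{ij}=h_{ikl}h_{klj}$. Then $\mathbf{e}\in\overline{\Sigma}_{[\mathbb{O}^-]}$ (i.e. $\mathbf{e}$ has at least cubic symmetry) if and only if $\mathbf{g}=0$ and $\mathbf{d}_2'=0$. Moreover, $\mathbf{e}\in\Sigma_{[\mathbb{O}^-]}$ (i.e. the symmetry group of $\mathbf{e}$ is conjugate in $\mathrm{O}(3)$ to $\mathbb{O}^-$) if and only if $\mathbf{g}=0$, $\mathbf{d}_2'=0$ and $\mathbf{h}\neq 0$.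
   Context: $\mathbb{P}\mathrm{iez}=\{\mathbf{e}\in\otimes^3\mathbb{R}^3: \mathrm{e}_{ijk}=\mathrm{e}_{ikj}\}$ (components in an orthonormal basis), with $\mathrm{O}(3)$-action $(g\cdot\mathbf{e})_{ijk}=g_{ia}g_{jb}g_{kc}\mathrm{e}_{abc}$ and norm $\|\mathbf{e}\|^2=\mathrm{e}_{ijk}\mathrm{e}_{ijk}$. $\mathbf{q}=(\delta_{ij})$. Totally symmetric part: $(\mathbf{e}^s)_{ijk}=\frac13(\mathrm{e}_{ijk}+\mathrm{e}_{jik}+\mathrm{e}_{kji})$; its trace is the vector $u_i=(\mathbf{e}^s)_{ikk}$; $(\mathbf{q}\odot\mathbf{u})_{ijk}=\frac13(\delta_{ij}u_k+\delta_{ik}u_j+\delta_{jk}u_i)$. The leading harmonic part of $\mathbf{e}$ is $\mathbf{h}=\mathbf{e}^s-\frac35\,\mathbf{q}\odot\mathbf{u}$, a totally symmetric traceless third-order tensor. $\mathbb{O}^-\subset\mathrm{O}(3)$ is the group of all orthogonal transformations preserving the regular tetrahedron with vertices $(1,1,1),(1,-1,-1),(-1,1,-1),(-1,-1,1)$ (order 24; notation of Golubitsky–Stewart–Schaeffer). Symmetry group: $G_{\mathbf{e}}=\{g\in\mathrm{O}(3): g\cdot\mathbf{e}=\mathbf{e}\}$. $\overline{\Sigma}_{[\mathbb{O}^-]}=\{\mathbf{e}:\exists g\in\mathrm{O}(3),\ g\mathbb{O}^-g^{-1}\subset G_{\mathbf{e}}\}$ and $\Sigma_{[\mathbb{O}^-]}=\{\mathbf{e}: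 G_{\mathbf{e}}=g\mathbb{O}^-g^{-1}\text{ for some }g\in\mathrm{O}(3)\}$. *)

(* Defs.v *)
From HB Require Import structures.
From mathcomp Require Import all_boot all_order all_algebra.
From mathcomp Require Import reals.
Set Implicit Arguments. Unset Strict Implicit. Unset Printing Implicit Defensive.
Import Order.TTheory GRing.Theory Num.Theory.
Local Open Scope ring_scope.

Section Defs.
Variable R : realType.

(* third-order tensors on R^3, components in the standard orthonormal basis *)
Definition tensor3 := 'I_3 -> 'I_3 -> 'I_3 -> R.

Definition kd (i j : 'I_3) : R := (i == j)%:R.

Definition is_piez (e : tensor3) : Prop := forall i j k, e i j k = e i k j.

Definition orthogonal (g : 'M[R]_3) : Prop := g^T *m g = 1%:M.

Definition act (g : 'M[R]_3) (e : tensor3) : tensor3 :=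
  fun i j k => \sum_(a < 3) \sum_(b < 3) \sum_(c < 3)
                 g i a * g j b * g k c * e a b c.

Definition in_sym_group (e : tensor3) (g : 'M[R]_3) : Prop :=
  orthogonal g /\ forall i j k, act g e i j k = e i j k.

Definition vec3 (x y z : R) : 'cV[R]_3 :=
  \col_(i < 3) (if i == 0 :> nat then x else if i == 1 :> nat then y else z).

Definition tetra (v : 'cV[R]_3) : Prop :=
  v = vec3 1 1 1 \/ v = vec3 1 (-1) (-1) \/ v = vec3 (-1) 1 (-1)
  \/ v = vec3 (-1) (-1) 1.

Definition in_Ominus (t : 'M[R]_3) : Prop :=
  orthogonal t /\ (forall v, tetra v -> tetra (t *m v))
  /\ (forall w, tetra w -> exists v, tetra v /\ t *m v = w).

Definition in_Sigma_bar_Ominus (e : tensor3) : Prop :=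
  exists g, orthogonal g /\
    forall t, in_Ominus t -> in_sym_group e (g *m t *m g^T).

Definition in_Sigma_Ominus (e : tensor3) : Prop :=
  exists g, orthogonal g /\
    forall s, in_sym_group e s <-> exists t, in_Ominus t /\ s = g *m t *m g^T.

Definition sym_part (e : tensor3) : tensor3 :=
  fun i j k => (e i j k + e j i k + e k j i) / 3%:R.

Definition trace_vec (e : tensor3) (i : 'I_3) : R :=
  \sum_(k < 3) sym_part e i k k.

Definition q_odot (u : 'I_3 -> R) : tensor3 :=
  fun i j k => (kd i j * u k + kd i k * u j + kd j k * u i) / 3%:R.

Definition harm (e : tensor3) : tensor3 :=
  fun i j k => sym_part e i j k - 3%:R / 5%:R * q_odot (trace_vec e) i j k.

Definition d2 (h : tensor3) (i j : 'I_3) : R :=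
  \sum_(k < 3) \sum_(l < 3) h i k l * h k l j.

Definition d2' (h : tensor3) (i j : 'I_3) : R :=
  d2 h i j - (\sum_(k < 3) d2 h k k) / 3%:R * kd i j.

End Defs.

(* Main.v *)
(** A tensor fixed by the tetrahedral group is a multiple of
    [tet], which is 1 on distinct indices and 0 elsewhere: the half-turns about the axes
    kill every other component and the 3-fold rotation equates the remaining
    ones.  Such a tensor is symmetric, traceless, with scalar [d2], and these
    properties are preserved by the orthogonal action.

    Conversely, let [h] be symmetric, traceless, with [d2 h] scalar, and take an
    orthonormal frame maximising [h 0 1 2] (the orthogonal group is compact).
    Criticality under rotations in the coordinate planes gives
    [h 0 1 1 = h 0 2 2 = x], [h 0 0 1 = h 1 2 2 = y], [h 0 0 2 = h 1 1 2 = z];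
    with [s = h 0 1 2], the condition on [d2] gives [x^2 = y^2 = z^2] and
    [x y = 4 z s].  Either [x = y = z = 0] and [h = s tet], or [x, y, z] are
    [+-4 s] and a half-turn yields the value [9 s], contradicting maximality.

    The stabiliser of [tet] is exactly the tetrahedral group, because the
    vertices of the tetrahedron are the vectors with [|v|^2 = 3] and [v0 v1 v2 = 1]
    (equality case of AM-GM), while [4 tet] is the sum of the cubes of the
    vertices. *)
From HB Require Import structures.
From mathcomp Require Import all_boot all_order all_algebra.
From mathcomp Require Import boolp classical_sets set_interval reals.
From mathcomp Require Import topology normedtype derive.
From mathcomp Require Import ring lra.
(* Last, since sesquilinear.v also has an [orthogonal]. *)
Require Import Defs.
Set Implicit Arguments. Unset Strict Implicit. Unset Printing Implicit Defensive.
Import Order.TTheory GRing.Theory Num.Theory numFieldNormedType.Exports.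
Local Open Scope ring_scope.

(** * Compactness of the orthogonal group and existence of a maximising frame *)

Section OrthogonalCompact.
Variable R : realType.
Implicit Types (h : tensor3 R) (p r : 'M[R]_3).
Local Open Scope classical_set_scope.

Lemma continuous_sum_ord (T : topologicalType) n (F : 'I_n -> T -> R) :
  (forall i, continuous (F i)) -> continuous (fun x => \sum_i F i x).
Proof.
move=> cF; elim: n F cF => [|n IH] F cF x.
  rewrite (_ : (fun _ => _) = fun=> 0); first exact: cvg_cst.
  by apply/funext => y; rewrite big_ord0.
rewrite (_ : (fun _ => _) =
  (fun y => \sum_(i < n) F (widen_ord (leqnSn n) i) y) \+ F ord_max).
  by apply: cvgD; [apply: IH | apply: cF].
by apply/funext => y; rewrite big_ord_recr.
Qed.

Lemma continuous_mulr (T : topologicalType) (F G : T -> R) :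
  continuous F -> continuous G -> continuous (fun x => F x * G x).
Proof. by move=> cF cG x; exact: (cvgM (cF x) (cG x)). Qed.

Lemma continuous_entry (i j : 'I_3) :
  continuous (fun u : 'rV[R]_(3 * 3) => vec_mx u i j).
Proof.
rewrite (_ : (fun _ => _) = fun u : 'rV[R]_(3 * 3) => u ord0 (mxvec_index i j)).
  exact: coord_continuous.
by apply/funext => u; rewrite mxE.
Qed.

(** The set is cut out by the nine polynomial equations of [orthogonal], hence closed, and it lies
    in a product of intervals [-1, 1] because the columns are unit vectors. Matrices are flattened
    to row vectors so that [rV_compact] provides the compact box. *)
Lemma compact_orthogonal :
  compact [set u : 'rV[R]_(3 * 3) | orthogonal (vec_mx u)].
Proof.
have cpt := @rV_compact _ _ _ (fun _ : 'I_(3 * 3) => @segment_compact R (-1) 1).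
apply: subclosed_compact cpt _.
- rewrite (_ : [set _ | _] = \bigcap_(ij in setT)
   ((fun u => \sum_k vec_mx u k ij.1 * vec_mx u k ij.2) @^-1`
     [set x | x = (1%:M : 'M[R]_3) ij.1 ij.2])).
    apply: closed_bigI => -[i j] _ /=; apply: preimage_closed; last exact: closed_eq.
    move=> u _; apply: continuous_sum_ord => k.
    by apply: continuous_mulr; exact: continuous_entry.
  apply/seteqP; split=> u /= ou.
    move=> [i j] _ /=; rewrite -ou [RHS]mxE.
    by apply: eq_bigr => k _; rewrite [(_^T) _ _]mxE.
  apply/matrixP => i j; rewrite -(ou (i, j)) //= [LHS]mxE.
  by apply: eq_bigr => k _; rewrite [(_^T) _ _]mxE.
- move=> u ou k; case/mxvec_indexP: k => i j.
  have := congr1 (fun A : 'M_3 => A j j) ou.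
  rewrite !mxE eqxx mulr1n (bigD1 i) //= => ouj.
  have uij : (u : 'rV[R]_(3 * 3)) ord0 (mxvec_index i j) ^+ 2 <= (1 : R).
    move: ouj; rewrite !mxE -expr2 => <-; rewrite lerDl sumr_ge0 // => k _.
    by rewrite !mxE -expr2 sqr_ge0.
  by rewrite /= in_itv /= -ler_norml -(@expr_le1 _ 2) // real_normK ?num_real.
Qed.

(** Extreme value theorem: a component of [act p h] is polynomial in the entries of [p]. *)
Lemma act_max h i j k : exists2 p, orthogonal p &
  forall r, orthogonal r -> act r h i j k <= act p h i j k.
Proof.
have cF : continuous (fun u : 'rV[R]_(3 * 3) => act (vec_mx u) h i j k).
  apply: continuous_sum_ord => a; apply: continuous_sum_ord => b.
  apply: continuous_sum_ord => c.
  apply: continuous_mulr; last exact: cst_continuous.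
  apply: continuous_mulr; last exact: continuous_entry.
  by apply: continuous_mulr; exact: continuous_entry.
have [|u uA umax] := compact_EVT_max _ compact_orthogonal (continuous_subspaceT cF).
  exists (mxvec 1%:M) => /=.
  by rewrite /orthogonal mxvecK trmx1 mul1mx.
exists (vec_mx u); first by move: uA; rewrite inE.
move=> r Or; rewrite -[r]mxvecK; apply: umax.
by rewrite inE /= mxvecK.
Qed.

End OrthogonalCompact.

Local Notation x0 := (@Ordinal 3 0 isT).
Local Notation x1 := (@Ordinal 3 1 isT).
Local Notation x2 := (@Ordinal 3 2 isT).

Lemma ord3_ind (P : 'I_3 -> Prop) : P x0 -> P x1 -> P x2 -> forall i, P i.
Proof.
move=> P0 P1 P2 [[|[|[|m]]] lt_m3] //.
- by rewrite (bool_irrelevance lt_m3 isT).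
- by rewrite (bool_irrelevance lt_m3 isT).
- by rewrite (bool_irrelevance lt_m3 isT).
Qed.

Lemma ord4_ind (P : 'I_4 -> Prop) :
  P (@Ordinal 4 0 isT) -> P (@Ordinal 4 1 isT) -> P (@Ordinal 4 2 isT) ->
  P (@Ordinal 4 3 isT) -> forall i, P i.
Proof.
by move=> P0 P1 P2 P3 [[|[|[|[|m]]]] lt_m] //; rewrite (bool_irrelevance lt_m isT).
Qed.

(** * The action of orthogonal matrices on third-order tensors *)

Section CubicTensors.
Variable R : realType.
Implicit Types (e f h : tensor3 R) (g p r s t : 'M[R]_3).

Lemma tensor_ext e f : (forall i j k, e i j k = f i j k) -> e = f.
Proof. by move=> ef; do 3 apply/funext => ?; exact: ef. Qed.

Lemma orthogonal_tr g : orthogonal g -> orthogonal g^T.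
Proof. by rewrite /orthogonal trmxK => /mulmx1C. Qed.

Lemma orthogonalM g p : orthogonal g -> orthogonal p -> orthogonal (g *m p).
Proof.
move=> og op; rewrite /orthogonal trmx_mul mulmxA -(mulmxA p^T) og mulmx1.
exact: op.
Qed.

(** In this nested form each index is contracted separately, so that facts about a single
    matrix-vector product can be applied slot by slot. *)
Lemma actE g e i j k : act g e i j k =
  \sum_(c < 3) g k c * (\sum_(b < 3) g j b * (\sum_(a < 3) g i a * e a b c)).
Proof. by rewrite /act !big_ord_recr !big_ord0 /=; ring. Qed.

Lemma act1 e : act 1%:M e = e.
Proof.
have id1 (x : 'I_3 -> R) i : \sum_a (1%:M : 'M[R]_3) i a * x a = x i.
  rewrite (bigD1 i) //= mxE eqxx mul1r big1 ?addr0 // => a.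
  by rewrite mxE eq_sym => /negPf ->; rewrite mul0r.
by apply: tensor_ext => i j k; rewrite actE !id1.
Qed.

Lemma act_comp g p e : act g (act p e) = act (g *m p) e.
Proof.
have slot (x : 'I_3 -> R) (m : 'I_3) :
    \sum_a (g *m p) m a * x a = \sum_a g m a * \sum_b p a b * x b.
  rewrite [RHS](eq_bigr (fun a => \sum_b g m a * p a b * x b)); last first.
    by move=> a _; rewrite big_distrr; apply: eq_bigr => b _ /=; rewrite mulrA.
  rewrite exchange_big; apply: eq_bigr => b _ /=.
  by rewrite mxE big_distrl.
have swap (x : 'I_3 -> R) (y : 'I_3 -> 'I_3 -> R) (z : 'I_3 -> R) :
    \sum_a x a * (\sum_b z b * y a b) = \sum_b z b * (\sum_a x a * y a b).
  by rewrite !big_ord_recr !big_ord0 /=; ring.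
apply: tensor_ext => i j k; rewrite !actE !slot.
apply: eq_bigr => c _; congr (_ * _).
under eq_bigr => b _.
  under eq_bigr => a _ do rewrite actE.
  over.
rewrite /=.
under eq_bigr => b _ do rewrite swap.
rewrite swap; apply: eq_bigr => c' _; congr (_ * _).
rewrite slot; apply: eq_bigr => b _; congr (_ * _).
rewrite swap; apply: eq_bigr => b' _; congr (_ * _).
by rewrite slot.
Qed.

(** A contracted pair of transformed indices absorbs [g]; the behaviour of traces and of [d2] under
    the action reduces to this. *)
Lemma orthogonal_dot g (x y : 'I_3 -> R) : orthogonal g ->
  \sum_k (\sum_a g k a * x a) * (\sum_b g k b * y b) = \sum_a x a * y a.
Proof.
move=> og; have ogE a b : \sum_k g k a * g k b = kd R a b.
  have := congr1 (fun A : 'M_3 => A a b) og; rewrite !mxE /kd => <-.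
  by apply: eq_bigr => k _; rewrite mxE.
transitivity (\sum_a \sum_b (\sum_k g k a * g k b) * (x a * y b)).
  by rewrite !big_ord_recr !big_ord0 /=; ring.
under eq_bigr => a _ do under eq_bigr => b _ do rewrite ogE.
by rewrite /kd !big_ord_recr !big_ord0 /=; ring.
Qed.

Lemma act_scale g (c : R) e : act g (fun i j k => c * e i j k) =
  fun i j k => c * act g e i j k.
Proof.
apply: tensor_ext => i j k; rewrite /act big_distrr; apply: eq_bigr => a _.
rewrite big_distrr; apply: eq_bigr => b _.
by rewrite big_distrr; apply: eq_bigr => d _ /=; rewrite mulrCA.
Qed.

Definition symmetric3 e :=
  (forall i j k, e i j k = e i k j) /\ (forall i j k, e i j k = e j i k).

Definition traceless e := forall i, \sum_k e i k k = 0.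

Lemma act_symmetric3 g e : symmetric3 e -> symmetric3 (act g e).
Proof.
move=> [s1 s2]; split=> i j k; rewrite /act.
  apply: eq_bigr => a _; rewrite exchange_big; apply: eq_bigr => b _.
  by apply: eq_bigr => c _ /=; rewrite s1; ring.
rewrite exchange_big; apply: eq_bigr => a _; apply: eq_bigr => b _.
by apply: eq_bigr => c _ /=; rewrite s2; ring.
Qed.

Lemma act_traceless g e : orthogonal g -> traceless e -> traceless (act g e).
Proof.
move=> og te i; under eq_bigr => k _ do rewrite actE.
pose x b c := \sum_a g i a * e a b c.
(* Inserting a Kronecker delta turns the trace into dot products of two transformed vectors. *)
transitivity (\sum_c \sum_k (\sum_a g k a * kd R a c) * (\sum_b g k b * x b c)).
  rewrite exchange_big; apply: eq_bigr => c _; apply: eq_bigr => k _.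
  congr (_ * _); rewrite (bigD1 c) //= /kd eqxx mulr1 big1 ?addr0 // => a /negPf ->.
  by rewrite mulr0.
under eq_bigr => c _ do rewrite orthogonal_dot //.
transitivity (\sum_a g i a * \sum_k e a k k); last first.
  by apply: big1 => a _; rewrite te mulr0.
by rewrite /x /kd !big_ord_recr !big_ord0 /=; ring.
Qed.

Lemma act_d2 g e i j : orthogonal g ->
  d2 (act g e) i j = \sum_a \sum_b g i a * g j b * d2 e a b.
Proof.
move=> og; rewrite /d2.
pose x b c := \sum_a g i a * e a b c; pose y a b := \sum_c g j c * e a b c.
transitivity (\sum_k \sum_l (\sum_c g l c * (\sum_b g k b * x b c)) *
                            (\sum_c g l c * (\sum_b g k b * y b c))).
  apply: eq_bigr => k _; apply: eq_bigr => l _; rewrite !actE; congr (_ * _).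
  by rewrite /y !big_ord_recr !big_ord0 /=; ring.
under eq_bigr => k _ do rewrite orthogonal_dot //.
rewrite exchange_big /=; under eq_bigr => c _ do rewrite orthogonal_dot //.
transitivity (\sum_c \sum_b \sum_a \sum_d g i a * g j d * (e a b c * e b c d)).
  apply: eq_bigr => c _; apply: eq_bigr => b _.
  by rewrite /x /y !big_ord_recr !big_ord0 /=; ring.
transitivity (\sum_a \sum_d \sum_b \sum_c g i a * g j d * (e a b c * e b c d)).
  rewrite exchange_big /=; under eq_bigr => b _ do rewrite exchange_big /=.
  rewrite exchange_big /=; apply: eq_bigr => a _.
  under eq_bigr => b _ do rewrite exchange_big /=.
  by rewrite exchange_big.
apply: eq_bigr => a _; apply: eq_bigr => b _; rewrite big_distrr.
by apply: eq_bigr => c _ /=; rewrite big_distrr.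
Qed.

Lemma sum3E (F : 'I_3 -> R) : \sum_(i < 3) F i = F x0 + F x1 + F x2.
Proof.
rewrite !big_ord_recr big_ord0 /= add0r.
by congr (_ + _ + _); congr (F _); apply: val_inj.
Qed.

(** * The harmonic part *)

Lemma harm_symmetric3 e : is_piez e -> symmetric3 (harm e).
Proof.
have kdC i j : kd R i j = kd R j i by rewrite /kd eq_sym.
move=> pe; split=> i j k; rewrite /harm /q_odot /sym_part.
  by rewrite (pe i k j) (pe k i j) (pe j k i) (kdC k j); field.
by rewrite (pe k i j) (kdC j i); field.
Qed.

(** The trace of [q_odot u] is 5/3 u, which the coefficient 3/5 normalises to u. *)
Lemma harm_traceless e : traceless (harm e).
Proof.
move=> i; rewrite /harm big_split /= -/(trace_vec e i).
set u := trace_vec e; rewrite sum3E /q_odot /kd !eqxx.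
by elim/ord3_ind: i => /=; field.
Qed.

Lemma harm_id e : symmetric3 e -> traceless e -> harm e = e.
Proof.
move=> [s1 s2] te; have se : sym_part e = e.
  apply: tensor_ext => i j k.
  by rewrite /sym_part (s2 j i k) (s1 k j i) (s2 k i j) (s1 i k j); field.
have u0 : trace_vec e = fun=> 0 by apply/funext => i; rewrite /trace_vec se te.
by apply: tensor_ext => i j k; rewrite /harm /q_odot u0 se; field.
Qed.

(** * Components in a frame that maximises the (0, 1, 2) entry *)

Definition mat3 (a b c a' b' c' a'' b'' c'' : R) : 'M[R]_3 :=
  \matrix_(i, j)
    nth 0 (nth [::] [:: [:: a; b; c]; [:: a'; b'; c']; [:: a''; b''; c'']] i) j.

Lemma orthogonal_mat3 a b c a' b' c' a'' b'' c'' :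
  a * a + a' * a' + a'' * a'' = 1 -> b * b + b' * b' + b'' * b'' = 1 ->
  c * c + c' * c' + c'' * c'' = 1 -> a * b + a' * b' + a'' * b'' = 0 ->
  a * c + a' * c' + a'' * c'' = 0 -> b * c + b' * c' + b'' * c'' = 0 ->
  orthogonal (mat3 a b c a' b' c' a'' b'' c'').
Proof.
move=> aa bb cc ab ac bc; apply/matrixP => i j; rewrite mxE sum3E !mxE.
elim/ord3_ind: i; elim/ord3_ind: j => /=;
 rewrite ?mulr1n ?mulr0n ?aa ?bb ?cc ?ab ?ac ?bc //.
- by rewrite -ab; ring.
- by rewrite -ac; ring.
- by rewrite -bc; ring.
Qed.

(** First-order criticality without derivatives: c and d are the cosine and sine of a rotation
    angle, and for small angles the linear term in d dominates the quadratic one, so D cannot be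
    positive. Changing d to -d excludes negative D. *)
Lemma rotation_critical (s D : R) : 0 <= s ->
  (forall c d : R, c * c + d * d = 1 -> c * d * D <= 2 * (d * d) * s) -> D = 0.
Proof.
move=> s0 crit.
have pos (D' : R) :
    (forall c d : R, c * c + d * d = 1 -> c * d * D' <= 2 * (d * d) * s) ->
    D' <= 0.
  move=> crit'; rewrite leNgt; apply/negP => D0.
  have den0 : 0 < 4 * s + 2 * D' by lra.
  (* t is the tangent of the half angle, giving a rational point of the circle. The inequality
     reduces to (1 - t^2) D' <= 4 t s, and this t satisfies 4 t s = D' - 2 t D'; hence 2 t <= t^2,
     which is impossible for 0 < t <= 1. *)
  pose t := D' / (4 * s + 2 * D').
  have t0 : 0 < t by rewrite divr_gt0.
  have tE : t * (4 * s + 2 * D') = D' by rewrite /t divfK // gt_eqF.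
  have t1 : t <= 1 by rewrite /t ler_pdivrMr //; lra.
  have q0 : 0 < 1 + t * t by nra.
  have := crit' ((1 - t * t) / (1 + t * t)) (2 * t / (1 + t * t)).
  have -> : (1 - t * t) / (1 + t * t) * ((1 - t * t) / (1 + t * t)) +
    2 * t / (1 + t * t) * (2 * t / (1 + t * t)) = 1 by field; rewrite gt_eqF.
  move=> /(_ erefl).
  have -> : (1 - t * t) / (1 + t * t) * (2 * t / (1 + t * t)) * D' =
    (2 * t * (1 - t * t) * D') / (1 + t * t) ^+ 2 by field; rewrite gt_eqF.
  have -> : 2 * (2 * t / (1 + t * t) * (2 * t / (1 + t * t))) * s =
    (8 * t * t * s) / (1 + t * t) ^+ 2 by field; rewrite gt_eqF.
  rewrite ler_pM2r ?invr_gt0 ?exprn_gt0 // => le.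
  have : (1 - t * t) * D' <= 4 * t * s.
    rewrite -(@ler_pM2l _ (2 * t)); last by lra.
    by lra.
  nra.
apply/eqP; rewrite eq_le pos //=.
rewrite -oppr_le0; apply: pos => c d cd.
have := crit c (- d); rewrite !mulNr !mulrN !mulNr opprK => /(_ cd); lra.
Qed.

Definition tet : tensor3 R := fun i j k => [&& i != j, j != k & i != k]%:R.

Lemma tet_symmetric3 : symmetric3 tet.
Proof.
by split=> i j k; rewrite /tet; elim/ord3_ind: i; elim/ord3_ind: j; elim/ord3_ind: k.
Qed.

Lemma tet_traceless : traceless tet.
Proof. by move=> i; rewrite /tet big1 // => k _; rewrite eqxx andbF. Qed.

Lemma d2_tet i j : d2 tet i j = 2 * kd R i j.
Proof.
rewrite /d2 !sum3E /tet /kd; elim/ord3_ind: i; elim/ord3_ind: j => /=; ring.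
Qed.

(** A product of equations rather than a conjunction, so that it serves as a rewrite rule sorting
    the indices of every component. *)
Lemma symmetric3E f : symmetric3 f ->
  (f x0 x1 x0 = f x0 x0 x1) * (f x1 x0 x0 = f x0 x0 x1) *
  (f x0 x2 x0 = f x0 x0 x2) * (f x2 x0 x0 = f x0 x0 x2) *
  (f x1 x0 x1 = f x0 x1 x1) * (f x1 x1 x0 = f x0 x1 x1) *
  (f x1 x2 x1 = f x1 x1 x2) * (f x2 x1 x1 = f x1 x1 x2) *
  (f x2 x0 x2 = f x0 x2 x2) * (f x2 x2 x0 = f x0 x2 x2) *
  (f x2 x1 x2 = f x1 x2 x2) * (f x2 x2 x1 = f x1 x2 x2) *
  ((f x0 x2 x1 = f x0 x1 x2) * (f x1 x0 x2 = f x0 x1 x2) *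
   (f x1 x2 x0 = f x0 x1 x2) * (f x2 x0 x1 = f x0 x1 x2) *
   (f x2 x1 x0 = f x0 x1 x2)).
Proof.
move=> [s1 s2]; have s3 i j k : f i j k = f k j i by rewrite s1 s2 s1.
have e021 : f x0 x2 x1 = f x0 x1 x2 by rewrite s1.
by do !split; rewrite ?(s3 x1 x2) ?(s2 x2 x0) ?(s1 x0 x2) //;
   first [by rewrite s1 | by rewrite s2 | by rewrite s3].
Qed.

(** Rotating in the plane of axes 0 and 1 changes the entry s = f 0 1 2 into (c^2 - d^2) s + c d (f
    1 1 2 - f 0 0 2); with c^2 + d^2 = 1, maximality is the hypothesis of [rotation_critical]. The
    other two planes are alike. *)
Lemma act_max_critical f : symmetric3 f ->
  (forall r, orthogonal r -> act r f x0 x1 x2 <= f x0 x1 x2) ->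
  [/\ 0 <= f x0 x1 x2, f x1 x1 x2 = f x0 x0 x2, f x1 x2 x2 = f x0 x0 x1
    & f x0 x2 x2 = f x0 x1 x1].
Proof.
move=> /symmetric3E fE fmax.
have sge0 : 0 <= f x0 x1 x2.
  (* The central inversion changes the sign of every third-order tensor, so the maximum is at least
     its own opposite. *)
  have o : orthogonal (mat3 (-1) 0 0 0 (-1) 0 0 0 (-1)).
    by apply: orthogonal_mat3; ring.
  have := fmax _ o; rewrite /act !sum3E !mxE /= !fE; lra.
split=> //; apply/eqP; rewrite -subr_eq0; apply/eqP;
  apply: (rotation_critical sge0) => c d cd.
- have o : orthogonal (mat3 c d 0 (- d) c 0 0 0 1).
    by apply: orthogonal_mat3; (ring || (rewrite -[RHS]cd; ring)).
  have := fmax _ o; rewrite /act !sum3E !mxE /= !fE; nra.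
- have o : orthogonal (mat3 c 0 d 0 1 0 (- d) 0 c).
    by apply: orthogonal_mat3; (ring || (rewrite -[RHS]cd; ring)).
  have := fmax _ o; rewrite /act !sum3E !mxE /= !fE; nra.
- have o : orthogonal (mat3 1 0 0 0 c d 0 (- d) c).
    by apply: orthogonal_mat3; (ring || (rewrite -[RHS]cd; ring)).
  have := fmax _ o; rewrite /act !sum3E !mxE /= !fE; nra.
Qed.

Lemma act_max_tet f (l : R) : symmetric3 f -> traceless f ->
  (forall i j, d2 f i j = l * kd R i j) ->
  (forall r, orthogonal r -> act r f x0 x1 x2 <= f x0 x1 x2) ->
  f = fun i j k => f x0 x1 x2 * tet i j k.
Proof.
move=> sf tf df fmax; have fE := symmetric3E sf.
have [sge0 zE yE xE] := act_max_critical sf fmax.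
have {tf} f3 i : f i i i = - (f i x0 x0 + f i x1 x1 + f i x2 x2 - f i i i).
  by have := tf i; rewrite sum3E; lra.
have f000 : f x0 x0 x0 = - 2 * f x0 x1 x1 by have := f3 x0; rewrite xE; lra.
have f111 : f x1 x1 x1 = - 2 * f x0 x0 x1 by have := f3 x1; rewrite !fE yE; lra.
have f222 : f x2 x2 x2 = - 2 * f x0 x0 x2 by have := f3 x2; rewrite !fE zE; lra.
have d00 := df x0 x0; have d11 := df x1 x1; have d22 := df x2 x2.
have d01 := df x0 x1.
rewrite /d2 !sum3E /kd /= !fE !(xE, yE, zE, f000, f111, f222) in
  d00 d11 d22 d01.
set s := f x0 x1 x2 in sge0 d00 d11 d22 d01 *.
set x := f x0 x1 x1 in xE f000 d00 d11 d22 d01 *.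
set y := f x0 x0 x1 in yE f111 d00 d11 d22 d01 *.
set z := f x0 x0 x2 in zE f222 d00 d11 d22 d01 *.
(* The (0, 1) entry of [d2 f] is 4 z s - x y, and two diagonal entries differ by 4 times the
   difference of the corresponding squares among x^2, y^2, z^2. *)
have xy : x * y = 4 * (z * s) by lra.
have xx_yy : x ^+ 2 = y ^+ 2 by lra.
have xx_zz : x ^+ 2 = z ^+ 2 by lra.
have [x_eq0|x_neq0] := eqVneq x 0.
  move: xx_yy xx_zz; rewrite x_eq0 expr0n /= => /esym/eqP; rewrite sqrf_eq0 => /eqP y_eq0.
  move=> /esym/eqP; rewrite sqrf_eq0 => /eqP z_eq0.
  apply: tensor_ext => i j k; rewrite /tet.
  by elim/ord3_ind: i; elim/ord3_ind: j; elim/ord3_ind: k => /=;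
    rewrite ?fE ?xE ?yE ?zE ?f000 ?f111 ?f222 -/x -/y -/z ?x_eq0 ?y_eq0 ?z_eq0
      ?mulr0 ?mulr1.
exfalso.
(* Square x y = 4 z s and cancel the common nonzero value of x^2, y^2 and z^2. *)
have x4s : x ^+ 2 = (4 * s) ^+ 2.
  apply: (mulfI (x := y ^+ 2)); first by rewrite -xx_yy sqrf_eq0.
  by rewrite -exprMn mulrC xy [RHS](_ : _ = y ^+ 2 * 16 * s ^+ 2);
     [rewrite -xx_yy xx_zz; ring | ring].
have s_gt0 : 0 < s.
  rewrite lt_neqAle sge0 andbT eq_sym; apply: contra_neq x_neq0 => s0.
  by move: x4s; rewrite s0 mulr0 expr0n => /eqP; rewrite sqrf_eq0 => /eqP.
(* [al] and [be] are the signs of x and y; the relation x y = 4 z s then makes [al * be] the sign of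
   z. *)
have [al [al2 xal]] : exists al : R, al * al = 1 /\ x = 4 * s * al.
  exists (x / (4 * s)); split; last by field; lra.
  by rewrite -expr2 exprMn x4s exprVn divff // sqrf_eq0; lra.
have [be [be2 ybe]] : exists be : R, be * be = 1 /\ y = 4 * s * be.
  exists (y / (4 * s)); split; last by field; lra.
  by rewrite -expr2 exprMn -xx_yy x4s exprVn divff // sqrf_eq0; lra.
have zab : z = 4 * s * (al * be).
  apply: (mulfI (x := 4 * s)); first by rewrite mulf_neq0 ?pnatr_eq0 ?gt_eqF.
  by rewrite -[LHS]mulrA [s * z]mulrC -xy xal ybe; ring.
have pm1 (c : R) : c * c = 1 -> c = 1 \/ c = -1.
  by rewrite -expr2 => /eqP; rewrite sqrf_eq1 => /orP[] /eqP; [left | right].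
(* the half-turn about (al, be, al * be) multiplies the (0, 1, 2) entry by 9 *)
have o : orthogonal (mat3 (- 1 / 3) (2 / 3 * (al * be)) (2 / 3 * be)
                          (2 / 3 * (al * be)) (- 1 / 3) (2 / 3 * al)
                          (2 / 3 * be) (2 / 3 * al) (- 1 / 3)).
  by apply: orthogonal_mat3; case: (pm1 al) => // ->; case: (pm1 be) => // ->; field.
have := fmax _ o; rewrite /act !sum3E !mxE /= !fE !(xE, yE, zE, f000, f111, f222).
rewrite -/x -/y -/z -/s xal ybe zab.
by case: (pm1 al) => // ->; case: (pm1 be) => // ->; lra.
Qed.

(** * The stabiliser of [tet] and the tensors fixed by the tetrahedral group *)

Lemma act_diag (d : 'rV[R]_3) f i j k :
  act (diag_mx d) f i j k = d ord0 i * d ord0 j * d ord0 k * f i j k.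
Proof.
have dE (x : 'I_3 -> R) m : \sum_a diag_mx d m a * x a = d ord0 m * x m.
  rewrite (bigD1 m) //= mxE eqxx mulr1n big1 ?addr0 // => a.
  by rewrite mxE eq_sym => /negPf ->; rewrite mulr0n mul0r.
by rewrite actE !dE; ring.
Qed.

(** The cubic form of [tet] is 6 v0 v1 v2, and an invariant tensor has an invariant cubic form. *)
Lemma act_tet_cubic t (v : 'cV[R]_3) : orthogonal t -> act t tet = tet ->
  (t *m v) x0 ord0 * (t *m v) x1 ord0 * (t *m v) x2 ord0 =
  v x0 ord0 * v x1 ord0 * v x2 ord0.
Proof.
move=> ot tt.
have tt' : act t^T tet = tet by rewrite -{1}tt act_comp ot act1.
(* With all rows equal to w, acting by this matrix evaluates the cubic form at w. Moreover
   [rows (t *m v)] is [rows v *m t^T], and [t^T] also fixes [tet]. *)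
pose rows (w : 'cV[R]_3) : 'M[R]_3 := \matrix_(i, j) w j ord0.
have cubic w : act (rows w) tet x0 x0 x0 = 6 * (w x0 ord0 * w x1 ord0 * w x2 ord0).
  by rewrite /act !sum3E /tet /= !mxE; ring.
apply: (mulfI (x := 6)); first by rewrite pnatr_eq0.
rewrite -!cubic -{2}tt' act_comp; congr (act _ _ _ _ _).
by apply/matrixP => i j; rewrite !mxE; apply: eq_bigr => a _; rewrite !mxE mulrC.
Qed.

Lemma tetraP (v : 'cV[R]_3) : tetra v <->
  \sum_i v i ord0 * v i ord0 = 3 /\ v x0 ord0 * v x1 ord0 * v x2 ord0 = 1.
Proof.
rewrite sum3E; split.
  by move=> [|[|[|]]] ->; rewrite !mxE /=; split; ring.
move=> [nv pv].
have sq1 (a b c : R) : a * a + b * b + c * c = 3 -> a * b * c = 1 -> a = 1 \/ a = -1.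
  move=> n p; have p2 : (a * a) * ((b * b) * (c * c)) = 1.
    by transitivity ((a * b * c) ^+ 2); [ring | rewrite p expr1n].
  (* This is a^2 times the discriminant (b^2 - c^2)^2 of the quadratic with roots b^2 and c^2, whose
     sum is 3 - a^2 and whose product is 1 / a^2. Since a^2 <= 3, the second factor is negative and
     a^2 = 1 follows. *)
  have : (a * a - 1) ^+ 2 * (a * a - 4) >= 0.
    have : (a * a) * (b * b - c * c) ^+ 2 >= 0.
      by rewrite mulr_ge0 ?sqr_ge0 // -expr2 sqr_ge0.
    suff -> : (a * a) * (b * b - c * c) ^+ 2 = (a * a - 1) ^+ 2 * (a * a - 4) by [].
    have bc : b * b + c * c = 3 - a * a by lra.
    rewrite (_ : _ * _ = (a * a) * (b * b + c * c) ^+ 2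
               - 4 * ((a * a) * ((b * b) * (c * c)))); last by ring.
    by rewrite p2 bc; ring.
  have a4 : a * a - 4 < 0 by nra.
  rewrite nmulr_lge0 // => le0.
  have /eqP : (a * a - 1) ^+ 2 = 0.
    by apply/eqP; rewrite eq_le le0 sqr_ge0.
  rewrite sqrf_eq0 subr_eq0 -expr2 sqrf_eq1 => /orP[] /eqP; [by left | by right].
have v0 := sq1 _ _ _ nv pv.
have v1 : v x1 ord0 = 1 \/ v x1 ord0 = -1.
  by apply: (sq1 _ (v x0 ord0) (v x2 ord0)); [rewrite -nv | rewrite -pv]; ring.
have v2 : v x2 ord0 = v x0 ord0 * v x1 ord0.
  by move: pv; case: v0 => ->; case: v1 => ->; lra.
have vE : v = vec3 (v x0 ord0) (v x1 ord0) (v x2 ord0).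
  by apply/matrixP => i j; rewrite ord1 !mxE; elim/ord3_ind: i.
rewrite vE v2 /tetra; case: v0 => ->; case: v1 => ->;
  by rewrite ?(mulN1r, mulrN1, mul1r, opprK); tauto.
Qed.

(** By [tetraP] the vertices are determined by norm and cubic form, both preserved by [t]; the
    transpose, which also fixes [tet], supplies preimages. *)
Lemma stab_tet_Ominus t : orthogonal t -> act t tet = tet -> in_Ominus t.
Proof.
have tetra_stab s v : orthogonal s -> act s tet = tet -> tetra v -> tetra (s *m v).
  move=> os ss /tetraP[nv pv]; apply/tetraP; rewrite act_tet_cubic //; split=> //.
  by rewrite -nv -[RHS](orthogonal_dot _ _ os); apply: eq_bigr => i _; rewrite mxE.
move=> ot tt; split=> //; split=> [v|w tw]; first exact: tetra_stab.
have tt' : act t^T tet = tet by rewrite -{1}tt act_comp ot act1.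
exists (t^T *m w); split; first exact: tetra_stab (orthogonal_tr ot) tt' tw.
by rewrite mulmxA (mulmx1C ot) mul1mx.
Qed.

(** Indexing the vertices by a finite type turns a tetrahedral matrix into an injective self-map of
    the index set, which can reindex sums. *)
Definition vertex (n : 'I_4) : 'cV[R]_3 :=
  nth 0 [:: vec3 1 1 1; vec3 1 (-1) (-1); vec3 (-1) 1 (-1); vec3 (-1) (-1) 1] n.

Lemma tetra_vertex v : tetra v <-> exists n, v = vertex n.
Proof.
split.
  by move=> [|[|[|]]] ->; [exists (@Ordinal 4 0 isT) | exists (@Ordinal 4 1 isT)
    | exists (@Ordinal 4 2 isT) | exists (@Ordinal 4 3 isT)].
by case=> n ->; rewrite /vertex /tetra; elim/ord4_ind: n => /=; tauto.
Qed.

Lemma vertex_inj : injective vertex.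
Proof.
move=> m n; rewrite /vertex => /matrixP vE.
have := vE x0 ord0; have := vE x1 ord0; have {vE} := vE x2 ord0.
by elim/ord4_ind: m; elim/ord4_ind: n => //=; rewrite !mxE /= => a b c; exfalso; lra.
Qed.

Lemma tet_vertex i j k : 4 * tet i j k =
  \sum_n vertex n i ord0 * vertex n j ord0 * vertex n k ord0.
Proof.
rewrite !big_ord_recr big_ord0 /= /vertex /= !mxE /tet.
by elim/ord3_ind: i; elim/ord3_ind: j; elim/ord3_ind: k => /=; ring.
Qed.

(** The matrix permutes the vertices, hence the terms of the sum of cubes in [tet_vertex]. *)
Lemma Ominus_act_tet t : in_Ominus t -> act t tet = tet.
Proof.
move=> [ot [tV _]].
have /fin_all_exists[sg sgE] : forall n, exists m, t *m vertex n = vertex m.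
  by move=> n; apply/tetra_vertex/tV/tetra_vertex; exists n.
have sg_inj : injective sg.
  move=> m n smn; apply: vertex_inj.
  by rewrite -[LHS]mul1mx -[RHS]mul1mx -ot -!mulmxA !sgE smn.
apply: tensor_ext => i j k; apply: (mulfI (x := 4)); first by rewrite pnatr_eq0.
rewrite tet_vertex [RHS](reindex_inj sg_inj) /=.
transitivity (act t (fun a b c => 4 * tet a b c) i j k); first by rewrite act_scale.
rewrite (_ : (fun _ _ _ => _) = fun a b c =>
   \sum_n vertex n a ord0 * vertex n b ord0 * vertex n c ord0); last first.
  by apply: tensor_ext => a b c; exact: tet_vertex.
rewrite /act !sum3E !big_distrr -!big_split; apply: eq_bigr => n _ /=.
by rewrite -!sgE !mxE !sum3E; ring.
Qed.

Lemma Ominus_fixed_tet f : is_piez f -> (forall t, in_Ominus t -> act t f = f) ->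
  f = fun i j k => f x0 x1 x2 * tet i j k.
Proof.
move=> pf Of.
(* The half-turn about axis m, as a diagonal matrix. *)
have fD m i j k : let sg a := (if a == m then 1 else -1) : R in
    f i j k = sg i * sg j * sg k * f i j k.
  move=> sg; pose d : 'rV[R]_3 := \row_a sg a.
  have actd e a b c : act (diag_mx d) e a b c = sg a * sg b * sg c * e a b c.
    by rewrite act_diag !mxE.
  rewrite -actd Of //; apply: stab_tet_Ominus.
    apply/matrixP => a b; rewrite tr_diag_mx mulmx_diag !mxE.
    by case: eqVneq => //= _; rewrite /sg; case: ifP => _; rewrite ?mulrNN mulr1.
  apply: tensor_ext => a b c; rewrite actd /sg /tet.
  by elim/ord3_ind: m @sg @d actd => ? ? _;
    elim/ord3_ind: a; elim/ord3_ind: b; elim/ord3_ind: c => /=; ring.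
(* The rotation of order 3 about (1, 1, 1), which permutes the axes cyclically. *)
have oC : orthogonal (mat3 (0 : R) 1 0 0 0 1 1 0 0) by apply: orthogonal_mat3; ring.
have fC : act (mat3 0 1 0 0 0 1 1 0 0) f = f.
  apply: Of; apply: stab_tet_Ominus => //; apply: tensor_ext => i j k.
  rewrite /act !sum3E !mxE /tet.
  by elim/ord3_ind: i; elim/ord3_ind: j; elim/ord3_ind: k => /=; ring.
have cyc1 : f x0 x1 x2 = f x1 x2 x0.
  by rewrite -{1}fC /act !sum3E !mxE /=; ring.
have cyc2 : f x1 x2 x0 = f x2 x0 x1.
  by rewrite -{1}fC /act !sum3E !mxE /=; ring.
apply: tensor_ext => i j k; rewrite /tet.
(* Two half-turns suffice: a surviving component has each of the indices 0 and 1 an odd number of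
   times, hence all three indices once. *)
have f0 := fD x0 i j k; have {fD} f1 := fD x1 i j k; have f01 := pf x0 x1 x2.
have f12 := pf x1 x2 x0; have f20 := pf x2 x0 x1.
by elim/ord3_ind: i f0 f1; elim/ord3_ind: j; elim/ord3_ind: k => /= f0 f1; lra.
Qed.

(** * Orbits of the multiples of [tet] and the two symmetry strata *)

Definition cubic (c : R) : tensor3 R := fun i j k => c * tet i j k.

Lemma in_sym_groupP e s : in_sym_group e s <-> orthogonal s /\ act s e = e.
Proof.
split=> -[os se]; split=> //; first exact: tensor_ext.
by move=> i j k; rewrite se.
Qed.

Lemma in_sym_group_act g e s : orthogonal g ->
  in_sym_group (act g e) s <-> in_sym_group e (g^T *m s *m g).
Proof.
move=> og; rewrite !in_sym_groupP; have og' := orthogonal_tr og.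
have gK f : act g^T (act g f) = f by rewrite act_comp og act1.
have gK' f : act g (act g^T f) = f by rewrite act_comp (mulmx1C og) act1.
split=> -[os se]; split.
- exact/orthogonalM/og/orthogonalM.
- by rewrite -!act_comp se gK.
- have -> : s = g *m (g^T *m s *m g) *m g^T.
    by rewrite !mulmxA (mulmx1C og) mul1mx -mulmxA (mulmx1C og) mulmx1.
  exact/orthogonalM/og'/orthogonalM.
- by rewrite -[RHS](congr1 (act g) se) -!act_comp gK'.
Qed.

Lemma in_sym_group_cubic c t : in_Ominus t -> in_sym_group (cubic c) t.
Proof.
move=> Ot; apply/in_sym_groupP; split; first by case: Ot.
by rewrite /cubic act_scale (Ominus_act_tet Ot).
Qed.

Lemma in_sym_group_cubic_neq0 c t :
  c != 0 -> in_sym_group (cubic c) t -> in_Ominus t.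
Proof.
move=> c0 /in_sym_groupP[ot]; rewrite /cubic act_scale => tE.
apply: stab_tet_Ominus => //; apply: tensor_ext => i j k; apply: (mulfI c0).
exact: (congr1 (fun e : tensor3 R => e i j k) tE).
Qed.

(** Pulling [e] back by the conjugating matrix gives a tensor fixed by the tetrahedral group itself,
    to which [Ominus_fixed_tet] applies. *)
Lemma Sigma_bar_cubic e : is_piez e ->
  in_Sigma_bar_Ominus e -> exists g c, orthogonal g /\ e = act g (cubic c).
Proof.
move=> pe [g [og Oe]]; have og' := orthogonal_tr og; pose f := act g^T e.
have ef : e = act g f by rewrite /f act_comp (mulmx1C og) act1.
have pf : is_piez f.
  move=> i j k; rewrite /f /act; apply: eq_bigr => a _; rewrite exchange_big.
  by apply: eq_bigr => b _; apply: eq_bigr => d _ /=; rewrite pe; ring.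
exists g, (f x0 x1 x2); split=> //; rewrite {1}ef; congr (act _ _).
apply: Ominus_fixed_tet => // t /Oe; rewrite {1}ef => /(in_sym_group_act _ _ og).
rewrite !mulmxA og mul1mx -mulmxA og mulmx1.
by move=> /in_sym_groupP[].
Qed.

Lemma act_cubic_Sigma_bar g c : orthogonal g -> in_Sigma_bar_Ominus (act g (cubic c)).
Proof.
move=> og; exists g; split=> // t Ot; apply/in_sym_group_act => //.
by rewrite !mulmxA og mul1mx -mulmxA og mulmx1; exact: in_sym_group_cubic.
Qed.

Lemma act_cubic_Sigma g c : orthogonal g -> c != 0 -> in_Sigma_Ominus (act g (cubic c)).
Proof.
move=> og c0; exists g; split=> // s; split.
  move=> /(in_sym_group_act _ _ og)/(in_sym_group_cubic_neq0 c0) Ot.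
  exists (g^T *m s *m g); split=> //.
  by rewrite !mulmxA (mulmx1C og) mul1mx -mulmxA (mulmx1C og) mulmx1.
move=> [t [Ot ->]]; apply/in_sym_group_act => //.
by rewrite !mulmxA og mul1mx -mulmxA og mulmx1; exact: in_sym_group_cubic.
Qed.

Lemma harm_act_cubic g c : orthogonal g -> harm (act g (cubic c)) = act g (cubic c).
Proof.
move=> og; have [s1 s2] := tet_symmetric3.
apply: harm_id; [apply: act_symmetric3 | apply: act_traceless => // i].
  by split=> i j k; rewrite /cubic; [rewrite s1 | rewrite s2].
by rewrite /cubic -big_distrr /= tet_traceless mulr0.
Qed.

Lemma act_d2_scalar g e (l : R) i j : orthogonal g ->
  (forall a b, d2 e a b = l * kd R a b) -> d2 (act g e) i j = l * kd R i j.
Proof.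
move=> og d2E; have ggE : \sum_k g i k * g j k = kd R i j.
  have := congr1 (fun A : 'M_3 => A i j) (mulmx1C og); rewrite !mxE /kd => <-.
  by apply: eq_bigr => k _; rewrite mxE.
rewrite act_d2 // -ggE big_distrr; apply: eq_bigr => k _ /=.
rewrite (bigD1 k) //= big1 ?addr0 => [|m /negPf mk]; rewrite d2E /kd.
  by rewrite eqxx /=; ring.
by rewrite eq_sym mk /=; ring.
Qed.

Lemma d2'_act_cubic g c i j : orthogonal g -> d2' (act g (cubic c)) i j = 0.
Proof.
move=> og; have d2E a b : d2 (act g (cubic c)) a b = 2 * c ^+ 2 * kd R a b.
  apply: act_d2_scalar => // k l.
  rewrite mulrAC -d2_tet mulrC /d2 !big_distrr; apply: eq_bigr => m _.
  by rewrite big_distrr; apply: eq_bigr => n _ /=; rewrite /cubic; ring.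
by rewrite /d2' d2E; under eq_bigr do rewrite d2E; rewrite sum3E /kd !eqxx /=; field.
Qed.

Lemma d2'_eq0_cubic e : symmetric3 e -> traceless e -> (forall i j, d2' e i j = 0) ->
  exists g c, orthogonal g /\ e = act g (cubic c).
Proof.
move=> se te de; have [p op pmax] := act_max e x0 x1 x2.
(* [p] carries [e] into its maximising frame, where it is a multiple of [tet]; [p^T] carries it
   back. *)
exists p^T, (act p e x0 x1 x2); split; first exact: orthogonal_tr.
pose l := (\sum_k d2 e k k) / 3.
have d2E a b : d2 e a b = l * kd R a b by apply/eqP; rewrite -subr_eq0; apply/eqP/de.
rewrite /cubic -(@act_max_tet (act p e) l).
- by rewrite act_comp op act1.
- exact: act_symmetric3.
- exact: act_traceless.
- by move=> i j; exact: act_d2_scalar.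
- by move=> r Or; rewrite act_comp; apply: pmax; exact: orthogonalM.
Qed.

(** The inversion distinguishes the zero tensor, which it fixes, from tensors with exactly
    tetrahedral symmetry: it makes the product of the coordinates of (1, 1, 1) equal to -1. *)
Lemma opp1_notin_Ominus : ~ in_Ominus (- 1%:M : 'M[R]_3).
Proof.
move=> [_ [/(_ (vec3 1 1 1))]]; rewrite mulNmx mul1mx => H _.
by have /tetraP[_] := H (or_introl erefl); rewrite !mxE /=; lra.
Qed.

Lemma Sigma_sub_Sigma_bar e : in_Sigma_Ominus e -> in_Sigma_bar_Ominus e.
Proof. by move=> [g [og gE]]; exists g; split=> // t Ot; apply/gE; exists t. Qed.

Lemma Sigma_neq0 e : in_Sigma_Ominus e -> exists i j k, e i j k <> 0.
Proof.
move=> [g [og gE]]; apply: contrapT => e0.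
have {}e0 i j k : e i j k = 0 by apply: contrapT => eijk; apply: e0; exists i, j, k.
have /gE[t [Ot tE]] : in_sym_group e (- 1%:M).
  split.
    rewrite /orthogonal (_ : (- 1%:M)^T = - 1%:M) ?mulNmx ?mulmxN ?opprK ?mul1mx //.
    by apply/matrixP => i j; rewrite !mxE eq_sym.
  move=> i j k; rewrite e0 /act big1 // => a _; rewrite big1 // => b _.
  by rewrite big1 // => c _; rewrite e0 mulr0.
apply: opp1_notin_Ominus; suff <- : t = - 1%:M by [].
(* The inversion is central, so undoing the conjugation returns it unchanged. *)
have := congr1 (fun s => g^T *m s *m g) tE.
rewrite /= mulmxN mulmx1 mulNmx og => ->.
by rewrite !mulmxA og mul1mx -mulmxA og mulmx1.
Qed.

End CubicTensors.

Theorem theorem7p1 (R : realType) (e : tensor3 R) :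
  is_piez e ->
  let h := harm e in
  let g := fun i j k => e i j k - h i j k in
  (in_Sigma_bar_Ominus e <->
     (forall i j k, g i j k = 0) /\ (forall i j, d2' h i j = 0)) /\
  (in_Sigma_Ominus e <->
     [/\ (forall i j k, g i j k = 0), (forall i j, d2' h i j = 0)
       & exists i j k, h i j k <> 0]).
Proof.
move=> pe h g.
have bar_h : in_Sigma_bar_Ominus e -> h = e /\ forall i j, d2' h i j = 0.
  move=> /(Sigma_bar_cubic pe)[p [c [op eE]]].
  have he : h = e by rewrite /h eE harm_act_cubic.
  by rewrite he; split=> // i j; rewrite eE d2'_act_cubic.
have g0 : h = e -> forall i j k, g i j k = 0 by move=> he i j k; rewrite /g he subrr.
have h_cubic : (forall i j k, g i j k = 0) -> (forall i j, d2' h i j = 0) ->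
    h = e /\ exists p c, orthogonal p /\ e = act p (cubic c).
  move=> g_eq0 d0; have he : h = e.
    by apply: tensor_ext => i j k; apply/esym/eqP; rewrite -subr_eq0; apply/eqP/g_eq0.
  split=> //; rewrite -he; apply: d2'_eq0_cubic d0.
    exact: harm_symmetric3.
  exact: harm_traceless.
split; split.
- by move=> /bar_h[/g0].
- by move=> [g_eq0 /(h_cubic g_eq0)[_ [p [c [op ->]]]]]; exact: act_cubic_Sigma_bar.
- move=> Se; have [he d0] := bar_h (Sigma_sub_Sigma_bar Se).
  by split=> //; [exact: g0 | rewrite he; exact: Sigma_neq0].
- move=> [g_eq0 d0 [i [j [k hijk]]]]; have [he [p [c [op eE]]]] := h_cubic g_eq0 d0.
  rewrite eE; apply: act_cubic_Sigma => //; apply/eqP => c0; apply: hijk.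
  rewrite he eE c0 /act big1 // => a _; rewrite big1 // => b _.
  by rewrite big1 // => d _; rewrite /cubic mul0r mulr0.
Qed.
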